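(* Let $u$ be a smooth $\mathbb{S}^1$-valued field on an open set $\Omega\subset\mathbb{R}^2$ satisfying $u^\perp\cdot\nabla\operatorname{div}u=0$, where $u^\perp=(-u_2,u_1)$. Writing $u$ locally via a lifting as $u(x)=e^{i\theta(x)}=(\cos\theta(x),\sin\theta(x))$ and setting $v:=\operatorname{div}u$, the equation $u^\perp\cdot\nabla\operatorname{div}u=0$ is equivalent to the system for the two scalars $\theta$ and $v$: $$-\sin\theta\,\theta_{x_1}+\cos\theta\,\theta_{x_2}=v,\qquad -\sin\theta\,v_{x_1}+\cos\theta\,v_{x_2}=0 .$$ Consequently, starting from any initial curve in $\Omega$ parametrized by $s\mapsto(x_1^0(s),x_2^0(s))$ along which $\theta$ and $v$ take the values $\theta_0(s)$ and $v_0(s)$ respectively, the characteristic curves $t\mapsto(x_1(s,t),x_2(s,t))$ are given, whenever $v_0(s)\ne0$, by $$x_1(s,t)=\frac1{v_0(s)}\big[\cos(v_0(s)t+\theta_0(s))-\cos\theta_0(s)\big]+x_1^0(s),$$ $$x_2(s,t)=\frac1{v_0(s)}\big[\sin(v_0(s)t+\theta_0(s))-\sin\theta_0(s)\big]+x_2^0(s),$$ and the corresponding solutions are $\theta(s,t)=v_0(s)t+\theta_0(s)$, $v(s,t)=v_0(s)$; so the characteristics are circular arcs of curvature $v_0(s)$ and carry constant values of the divergence. If $v_0(s)=0$, the characteristic is a straight line.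
   Context: The characteristic curves of the system are the solutions of $\partial_tx_1=-\sin\theta$, $\partial_tx_2=\cos\theta$ with $(x_1,x_2)(s,0)=(x_1^0(s),x_2^0(s))$, and $\theta(s,t)$, $v(s,t)$ denote the values of $\theta$, $v$ at $(x_1(s,t),x_2(s,t))$ (as long as the curve stays in the domain where the lifting is defined). *)

(* Defs.v *)
From Stdlib Require Export Reals.
From Coquelicot Require Export Coquelicot.
Open Scope R_scope.

Definition d1 (f : R * R -> R) (p : R * R) : R :=
  Derive (fun z => f (z, snd p)) (fst p).
Definition d2 (f : R * R -> R) (p : R * R) : R :=
  Derive (fun z => f (fst p, z)) (snd p).

Definition grad (f : R * R -> R) (p : R * R) : R * R := (d1 f p, d2 f p).

Definition div (u : R * R -> R * R) (p : R * R) : R :=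
  d1 (fun q => fst (u q)) p + d2 (fun q => snd (u q)) p.

Definition perp (w : R * R) : R * R := (- snd w, fst w).
Definition dot (w z : R * R) : R := fst w * fst z + snd w * snd z.

(* [Derive] is total, so differentiability of a field is asserted only here:
   on an open set [U] the condition below says that all iterated partial
   derivatives of [f] exist and are continuous, i.e. that [f] is of class
   C^infinity on [U]. *)
Definition smooth_on (U : R * R -> Prop) (f : R * R -> R) : Prop :=
  forall p, U p -> forall n : nat,
    ex_diff_n (fun x y => f (x, y)) n (fst p) (snd p).

Definition smooth_circle_field (U : R * R -> Prop) (u : R * R -> R * R) : Prop :=
  smooth_on U (fun p => fst (u p)) /\ smooth_on U (fun p => snd (u p)) /\
  forall p, U p -> fst (u p) ^ 2 + snd (u p) ^ 2 = 1.

Definition subset (U V : R * R -> Prop) : Prop := forall p, U p -> V p.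

Definition is_lifting (U : R * R -> Prop) (u : R * R -> R * R)
    (theta : R * R -> R) : Prop :=
  smooth_on U theta /\ forall p, U p -> u p = (cos (theta p), sin (theta p)).

Definition div_equation (U : R * R -> Prop) (u : R * R -> R * R) : Prop :=
  forall p, U p -> dot (perp (u p)) (grad (div u) p) = 0.

Definition scalar_system (U : R * R -> Prop) (theta v : R * R -> R) : Prop :=
  forall p, U p ->
    - sin (theta p) * d1 theta p + cos (theta p) * d2 theta p = v p /\
    - sin (theta p) * d1 v p + cos (theta p) * d2 v p = 0.

Definition in_time (a b : Rbar) (t : R) : Prop := Rbar_lt a t /\ Rbar_lt t b.

(* The curve [t |-> (x1 t, x2 t)] is the characteristic issued from
   [(y1, y2)] at time 0, on the time interval ]a, b[. *)
Definition is_characteristic (theta : R * R -> R) (y1 y2 : R) (a b : Rbar)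
    (x1 x2 : R -> R) : Prop :=
  x1 0 = y1 /\ x2 0 = y2 /\
  forall t, in_time a b t ->
    is_derive x1 t (- sin (theta (x1 t, x2 t))) /\
    is_derive x2 t (cos (theta (x1 t, x2 t))).

(* Signed curvature of a parametrized plane curve. *)
Definition curvature (x1 x2 : R -> R) (t : R) : R :=
  (Derive x1 t * Derive_n x2 2 t - Derive x2 t * Derive_n x1 2 t)
  / sqrt (Derive x1 t ^ 2 + Derive x2 t ^ 2) ^ 3.

Definition on_circle (c : R * R) (r : R) (p : R * R) : Prop :=
  (fst p - fst c) ^ 2 + (snd p - snd c) ^ 2 = r ^ 2.

(* Main.v *)
(* Along a characteristic the chain rule turns the system into the linear
   equations v' = 0 and theta' = v; hence v is constant, theta is affine in t,
   and the curve is the primitive of (- sin, cos) of an affine angle.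
   Conversely, let a curve in the domain of the lifting have that prescribed
   affine tangent angle.  The system bounds the derivatives of the errors in
   theta and v along it by a locally bounded multiple of these errors, so by
   Gronwall they vanish and the curve is a characteristic.
   A local lifting is obtained from an arctangent relative to u(p); it is smooth
   because d theta = u_1 d u_2 - u_2 d u_1. *)
From Stdlib Require Import Lra Lia.
Require Import Defs.

(** * Functions of class C^n on an open set *)

(** One finite order of [smooth_on], isolated so that regularity can be proved by induction on
    [n]. *)
Definition Cn_on (U : R * R -> Prop) (n : nat) (f : R * R -> R) : Prop :=
  forall p, U p -> ex_diff_n (fun x y => f (x, y)) n (fst p) (snd p).

Lemma open_locally_2d (U : R * R -> Prop) (p : R * R) :
  open U -> U p -> locally_2d (fun x y => U (x, y)) (fst p) (snd p).
Proof.
  intros HU Hp. apply locally_2d_locally.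
  destruct p as [x y]; simpl.
  generalize (HU _ Hp). apply filter_imp. intros [z w]; auto.
Qed.

Lemma locally_2d_open (U : R * R -> Prop) :
  (forall p, U p -> locally_2d (fun x y => U (x, y)) (fst p) (snd p)) -> open U.
Proof.
  intros H [x y] Hp. generalize (proj1 (locally_2d_locally _ _ _) (H _ Hp)).
  apply filter_imp. intros [z w]; auto.
Qed.

Lemma d1_ext_on (U : R * R -> Prop) (f g : R * R -> R) (p : R * R) :
  open U -> (forall q, U q -> f q = g q) -> U p -> d1 f p = d1 g p.
Proof.
  intros HU Hfg Hp. apply Derive_ext_loc.
  generalize (locally_2d_1d_const_y _ _ _ (open_locally_2d U p HU Hp)).
  apply filter_imp. intros t Ht. now apply Hfg.
Qed.

Lemma d2_ext_on (U : R * R -> Prop) (f g : R * R -> R) (p : R * R) :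
  open U -> (forall q, U q -> f q = g q) -> U p -> d2 f p = d2 g p.
Proof.
  intros HU Hfg Hp. apply Derive_ext_loc.
  generalize (locally_2d_1d_const_x _ _ _ (open_locally_2d U p HU Hp)).
  apply filter_imp. intros t Ht. now apply Hfg.
Qed.

Lemma Cn_on_ext (U : R * R -> Prop) (n : nat) (f g : R * R -> R) :
  open U -> (forall q, U q -> f q = g q) -> Cn_on U n f -> Cn_on U n g.
Proof.
  intros HU Hfg Hf p Hp.
  apply ex_diff_n_ext_loc with (fun x y => f (x, y)); [|now apply Hf].
  destruct (open_locally_2d U p HU Hp) as [e He].
  exists e. intros x y Hx Hy. now apply Hfg, He.
Qed.

Lemma Cn_on_continuity (U : R * R -> Prop) (n : nat) (f : R * R -> R) (p : R * R) :
  Cn_on U n f -> U p -> continuity_2d_pt (fun x y => f (x, y)) (fst p) (snd p).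
Proof. intros Hf Hp. specialize (Hf p Hp). destruct n; apply Hf. Qed.

(** Peels one level off [ex_diff_n] and exposes the partial derivatives as the fields [d1 f] and
    [d2 f], the form used by the inductions on the order. *)
Lemma Cn_on_S (U : R * R -> Prop) (n : nat) (f : R * R -> R) :
  Cn_on U (S n) f <->
  (forall p, U p ->
     continuity_2d_pt (fun x y => f (x, y)) (fst p) (snd p) /\
     ex_derive (fun z => f (z, snd p)) (fst p) /\
     ex_derive (fun z => f (fst p, z)) (snd p)) /\
  Cn_on U n (d1 f) /\ Cn_on U n (d2 f).
Proof.
  split.
  - intros Hf. split; [|split]; intros p Hp;
      destruct (Hf p Hp) as [? [? [? [? ?]]]]; auto.
  - intros [H0 [H1 H2]] p Hp. destruct (H0 p Hp) as [? [? ?]].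
    do 4 (split; auto).
Qed.

Lemma Cn_on_pred (U : R * R -> Prop) (n : nat) (f : R * R -> R) :
  Cn_on U (S n) f -> Cn_on U n f.
Proof. intros Hf p Hp. apply ex_diff_n_m with (S n); [lia | now apply Hf]. Qed.

Lemma Cn_on_plus (U : R * R -> Prop) (n : nat) (f g : R * R -> R) :
  open U -> Cn_on U n f -> Cn_on U n g -> Cn_on U n (fun q => f q + g q).
Proof.
  intros HU. revert f g. induction n as [|n IH]; intros f g Hf Hg.
  - intros p Hp. split; [|exact I].
    apply continuity_2d_pt_plus; eapply Cn_on_continuity; eauto.
  - apply Cn_on_S in Hf. apply Cn_on_S in Hg.
    destruct Hf as [Hf [Hf1 Hf2]], Hg as [Hg [Hg1 Hg2]].
    apply Cn_on_S. split; [|split].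
    + intros p Hp. destruct (Hf p Hp) as [? [? ?]], (Hg p Hp) as [? [? ?]].
      split; [|split].
      * now apply continuity_2d_pt_plus.
      * now apply (ex_derive_plus (fun z => f (z, snd p)) (fun z => g (z, snd p))).
      * now apply (ex_derive_plus (fun z => f (fst p, z)) (fun z => g (fst p, z))).
    + apply Cn_on_ext with (fun q => d1 f q + d1 g q); auto.
      intros q Hq. symmetry. destruct (Hf q Hq) as [_ [? _]], (Hg q Hq) as [_ [? _]].
      now apply Derive_plus.
    + apply Cn_on_ext with (fun q => d2 f q + d2 g q); auto.
      intros q Hq. symmetry. destruct (Hf q Hq) as [_ [_ ?]], (Hg q Hq) as [_ [_ ?]].
      now apply Derive_plus.
Qed.

Lemma Cn_on_opp (U : R * R -> Prop) (n : nat) (f : R * R -> R) :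
  open U -> Cn_on U n f -> Cn_on U n (fun q => - f q).
Proof.
  intros HU. revert f. induction n as [|n IH]; intros f Hf.
  - intros p Hp. split; [|exact I].
    apply continuity_2d_pt_opp; eapply Cn_on_continuity; eauto.
  - apply Cn_on_S in Hf. destruct Hf as [Hf [Hf1 Hf2]].
    apply Cn_on_S. split; [|split].
    + intros p Hp. destruct (Hf p Hp) as [? [? ?]].
      split; [|split].
      * now apply continuity_2d_pt_opp.
      * now apply (ex_derive_opp (fun z => f (z, snd p))).
      * now apply (ex_derive_opp (fun z => f (fst p, z))).
    + apply Cn_on_ext with (fun q => - d1 f q); auto.
      intros q Hq. symmetry. apply Derive_opp.
    + apply Cn_on_ext with (fun q => - d2 f q); auto.
      intros q Hq. symmetry. apply Derive_opp.
Qed.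

Lemma Cn_on_mult (U : R * R -> Prop) (n : nat) (f g : R * R -> R) :
  open U -> Cn_on U n f -> Cn_on U n g -> Cn_on U n (fun q => f q * g q).
Proof.
  intros HU. revert f g. induction n as [|n IH]; intros f g Hf Hg.
  - intros p Hp. split; [|exact I].
    apply continuity_2d_pt_mult; eapply Cn_on_continuity; eauto.
  (* The Leibniz formula for the partial derivatives contains [f] and [g] themselves, hence the need
     for them at order [n]. *)
  - pose proof (Cn_on_pred _ _ _ Hf) as Hf0. pose proof (Cn_on_pred _ _ _ Hg) as Hg0.
    apply Cn_on_S in Hf. apply Cn_on_S in Hg.
    destruct Hf as [Hf [Hf1 Hf2]], Hg as [Hg [Hg1 Hg2]].
    apply Cn_on_S. split; [|split].
    + intros p Hp. destruct (Hf p Hp) as [? [? ?]], (Hg p Hp) as [? [? ?]].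
      split; [|split].
      * now apply continuity_2d_pt_mult.
      * now apply (ex_derive_mult (fun z => f (z, snd p)) (fun z => g (z, snd p))).
      * now apply (ex_derive_mult (fun z => f (fst p, z)) (fun z => g (fst p, z))).
    + apply Cn_on_ext with (fun q => d1 f q * g q + f q * d1 g q); auto using Cn_on_plus.
      intros [x y] Hq. symmetry. destruct (Hf _ Hq) as [_ [? _]], (Hg _ Hq) as [_ [? _]].
      now apply (Derive_mult (fun z => f (z, y)) (fun z => g (z, y)) x).
    + apply Cn_on_ext with (fun q => d2 f q * g q + f q * d2 g q); auto using Cn_on_plus.
      intros [x y] Hq. symmetry. destruct (Hf _ Hq) as [_ [_ ?]], (Hg _ Hq) as [_ [_ ?]].
      now apply (Derive_mult (fun z => f (x, z)) (fun z => g (x, z)) y).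
Qed.

Lemma Cn_on_div (U : R * R -> Prop) (n : nat) (u : R * R -> R * R) :
  open U -> Cn_on U (S n) (fun q => fst (u q)) -> Cn_on U (S n) (fun q => snd (u q)) ->
  Cn_on U n (div u).
Proof.
  intros HU H1 H2. apply Cn_on_S in H1. apply Cn_on_S in H2.
  now apply Cn_on_plus.
Qed.

(** * Chain rules *)

(** The chain rule needs total differentiability. It follows because [d1 f] exists near the point
    and is continuous there, while [d2 f] exists at the point. *)
Lemma is_derive_along (U : R * R -> Prop) (f : R * R -> R) (x1 x2 : R -> R) (t l1 l2 : R) :
  open U -> Cn_on U 1 f -> U (x1 t, x2 t) ->
  is_derive x1 t l1 -> is_derive x2 t l2 ->
  is_derive (fun z => f (x1 z, x2 z)) t
    (d1 f (x1 t, x2 t) * l1 + d2 f (x1 t, x2 t) * l2).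
Proof.
  intros HU Hf Hp H1 H2. apply is_derive_Reals.
  apply (derivable_pt_lim_comp_2d (fun x y => f (x, y))); try now apply is_derive_Reals.
  destruct (proj1 (Cn_on_S U 0 f) Hf) as [H0 [Hf1 Hf2]].
  apply filterdiff_differentiable_pt_lim.
  apply (filterdiff_ext_lin _
    (fun w : R * R => plus (scal (fst w) (d1 f (x1 t, x2 t))) (scal (snd w) (d2 f (x1 t, x2 t)))));
    [|now intros].
  apply (is_derive_filterdiff (fun x y => f (x, y)) (x1 t) (x2 t) (fun x y => d1 f (x, y))).
  - apply (locally_2d_locally (fun a b => is_derive (fun x => f (x, b)) a (d1 f (a, b)))).
    destruct (open_locally_2d U _ HU Hp) as [e He].
    exists e. intros a b Ha Hb. apply Derive_correct, (H0 (a, b)). now apply He.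
  - apply Derive_correct, (H0 _ Hp).
  - generalize (Cn_on_continuity U 0 (d1 f) _ Hf1 Hp). simpl. intros Hc.
    apply continuity_2d_pt_filterlim in Hc. exact Hc.
Qed.

Lemma d1_cos (theta : R * R -> R) (p : R * R) :
  ex_derive (fun z => theta (z, snd p)) (fst p) ->
  d1 (fun q => cos (theta q)) p = - sin (theta p) * d1 theta p.
Proof.
  destruct p as [x y]; simpl; intros H. unfold d1; simpl.
  rewrite (Derive_comp cos (fun z => theta (z, y))), (is_derive_unique _ _ _ (is_derive_cos _));
    auto; [ring | eexists; apply is_derive_cos].
Qed.

Lemma d1_sin (theta : R * R -> R) (p : R * R) :
  ex_derive (fun z => theta (z, snd p)) (fst p) ->
  d1 (fun q => sin (theta q)) p = cos (theta p) * d1 theta p.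
Proof.
  destruct p as [x y]; simpl; intros H. unfold d1; simpl.
  rewrite (Derive_comp sin (fun z => theta (z, y))), (is_derive_unique _ _ _ (is_derive_sin _));
    auto; [ring | eexists; apply is_derive_sin].
Qed.

Lemma d2_cos (theta : R * R -> R) (p : R * R) :
  ex_derive (fun z => theta (fst p, z)) (snd p) ->
  d2 (fun q => cos (theta q)) p = - sin (theta p) * d2 theta p.
Proof.
  destruct p as [x y]; simpl; intros H. unfold d2; simpl.
  rewrite (Derive_comp cos (fun z => theta (x, z))), (is_derive_unique _ _ _ (is_derive_cos _));
    auto; [ring | eexists; apply is_derive_cos].
Qed.

Lemma d2_sin (theta : R * R -> R) (p : R * R) :
  ex_derive (fun z => theta (fst p, z)) (snd p) ->
  d2 (fun q => sin (theta q)) p = cos (theta p) * d2 theta p.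
Proof.
  destruct p as [x y]; simpl; intros H. unfold d2; simpl.
  rewrite (Derive_comp sin (fun z => theta (x, z))), (is_derive_unique _ _ _ (is_derive_sin _));
    auto; [ring | eexists; apply is_derive_sin].
Qed.

(** * The divergence equation as a system for the angle and the divergence *)

(** The divergence of (cos theta, sin theta) is the derivative of [theta] in the direction
    [perp u]. *)
Lemma div_lifting (U : R * R -> Prop) (u : R * R -> R * R) (theta : R * R -> R) (p : R * R) :
  open U -> is_lifting U u theta -> U p ->
  div u p = - sin (theta p) * d1 theta p + cos (theta p) * d2 theta p.
Proof.
  intros HU [Hth Hu] Hp. unfold div.
  destruct (Hth p Hp 1%nat) as [_ [E1 [E2 _]]].
  rewrite (d1_ext_on U _ (fun q => cos (theta q)) p HU) by
    (auto; intros q Hq; now rewrite Hu).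
  rewrite (d2_ext_on U _ (fun q => sin (theta q)) p HU) by
    (auto; intros q Hq; now rewrite Hu).
  now rewrite d1_cos, d2_sin.
Qed.

(** By [div_lifting] the first scalar equation says that [v] is the divergence. Then [v] and [div u]
    agree on an open set, so their gradients agree there and the second equation is the divergence
    equation. *)
Lemma div_equation_iff_scalar_system (U : R * R -> Prop) (u : R * R -> R * R)
    (theta v : R * R -> R) :
  open U -> is_lifting U u theta ->
  ((forall p, U p -> v p = div u p) /\ div_equation U u) <-> scalar_system U theta v.
Proof.
  intros HU Hl.
  assert (Hdot : forall p, U p -> (forall q, U q -> v q = div u q) ->
    dot (perp (u p)) (grad (div u) p) =
    - sin (theta p) * d1 v p + cos (theta p) * d2 v p).
  { intros p Hp Hv. rewrite (proj2 Hl p Hp). unfold dot, perp, grad; simpl.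
    now rewrite (d1_ext_on U v (div u) p HU Hv Hp), (d2_ext_on U v (div u) p HU Hv Hp). }
  split.
  - intros [Hv He] p Hp. split.
    + rewrite Hv by auto. symmetry. now apply div_lifting with U.
    + rewrite <- Hdot by auto. now apply He.
  - intros Hs.
    assert (Hv : forall p, U p -> v p = div u p).
    { intros p Hp. rewrite (div_lifting U u theta p) by auto. symmetry. now apply Hs. }
    split; auto. intros p Hp. rewrite Hdot by auto. now apply Hs.
Qed.

(** * Smooth local liftings *)

(** [acos a] covers the upper half circle; the sign of [b] decides between it and its opposite. *)
Lemma unit_vector_angle (a b : R) :
  a ^ 2 + b ^ 2 = 1 -> exists alpha, cos alpha = a /\ sin alpha = b.
Proof.
  intros H. assert (Ha : -1 <= a <= 1) by nra.
  destruct (Rle_dec 0 b) as [Hb|Hb].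
  - exists (acos a). rewrite cos_acos, sin_acos by auto. split; auto.
    replace (1 - a²) with (b²) by (unfold Rsqr; nra). now apply sqrt_Rsqr.
  - exists (- acos a). rewrite cos_neg, sin_neg, cos_acos, sin_acos by auto. split; auto.
    replace (1 - a²) with ((-b)²) by (unfold Rsqr; nra). rewrite sqrt_Rsqr; lra.
Qed.

(* The angle from the unit vector [(cos alpha, sin alpha)] to [(c, s)] has
   cosine [C] and sine [D]; for [C > 0] it is [atan (D / C)]. *)
Lemma angle_from_reference (alpha c s : R) :
  c ^ 2 + s ^ 2 = 1 ->
  let C := cos alpha * c + sin alpha * s in
  let D := cos alpha * s - sin alpha * c in
  0 < C ->
  cos (alpha + atan (D / C)) = c /\ sin (alpha + atan (D / C)) = s.
Proof.
  intros H C D HC.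
  pose proof (sin2_cos2 alpha) as Hal. unfold Rsqr in Hal.
  (* A product of two sums of two squares is again such a sum: [C] and [D] are the coordinates of
     (c, s) in the frame rotated by [alpha]. *)
  assert (HCD : C * C + D * D = 1).
  { replace 1 with ((sin alpha * sin alpha + cos alpha * cos alpha) * (c ^ 2 + s ^ 2))
      by (rewrite H, Hal; ring). unfold C, D; ring. }
  (* Here 1 + (D/C)^2 = (1/C)^2, and [C] > 0 selects the root; so the arctangent has cosine [C] and
     sine [D], with the right signs. *)
  assert (Hs : sqrt (1 + (D / C)²) = / C).
  { replace (1 + (D / C)²) with ((/ C)²).
    - apply sqrt_Rsqr. left. now apply Rinv_0_lt_compat.
    - unfold Rsqr. replace 1 with ((C * C + D * D) * (/ C * / C) - (D / C) * (D / C) + (1 - / C * / C * (C * C)))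
        by (field; lra). rewrite HCD. field. lra. }
  assert (H1 : cos (atan (D / C)) = C) by (rewrite cos_atan, Hs; field; lra).
  assert (H2 : sin (atan (D / C)) = D) by (rewrite sin_atan, Hs; field; lra).
  rewrite cos_plus, sin_plus, H1, H2. split.
  - replace c with (c * (sin alpha * sin alpha + cos alpha * cos alpha)) at 1
      by (rewrite Hal; ring). unfold C, D; ring.
  - replace s with (s * (sin alpha * sin alpha + cos alpha * cos alpha)) at 1
      by (rewrite Hal; ring). unfold C, D; ring.
Qed.

Lemma ex_derive_angle (alpha : R) (f g : R -> R) (x : R) :
  ex_derive f x -> ex_derive g x -> 0 < cos alpha * f x + sin alpha * g x ->
  ex_derive (fun z => alpha + atan ((cos alpha * g z - sin alpha * f z)
                                    / (cos alpha * f z + sin alpha * g z))) x.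
Proof.
  intros Hf Hg H. auto_derive. repeat split; auto. lra.
Qed.

(** Differentiating cos theta = u1 and sin theta = u2 expresses both partial derivatives of [theta]
    through [u1], [u2] and their derivatives only. They are therefore of every order at once,
    without a bootstrap on [theta]. *)
Lemma lifting_smooth (U : R * R -> Prop) (u1 u2 theta : R * R -> R) :
  open U -> smooth_on U u1 -> smooth_on U u2 ->
  (forall p, U p ->
     continuity_2d_pt (fun x y => theta (x, y)) (fst p) (snd p) /\
     ex_derive (fun z => theta (z, snd p)) (fst p) /\
     ex_derive (fun z => theta (fst p, z)) (snd p)) ->
  (forall p, U p -> cos (theta p) = u1 p /\ sin (theta p) = u2 p) ->
  smooth_on U theta.
Proof.
  intros HU H1 H2 Ht Hu.
  assert (HC1 : forall n, Cn_on U n u1) by (intros n p Hp; now apply H1).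
  assert (HC2 : forall n, Cn_on U n u2) by (intros n p Hp; now apply H2).
  assert (Hcs : forall a b : R, a = (sin b * sin b + cos b * cos b) * a).
  { intros a b. pose proof (sin2_cos2 b) as E. unfold Rsqr in E. rewrite E. ring. }
  intros p Hp n. revert p Hp. change (Cn_on U n theta).
  (* Proving order [n + 1] instead of [n] makes [Cn_on_S] applicable also when [n] is 0. *)
  apply Cn_on_pred, Cn_on_S. split; [exact Ht | split].
  - destruct (proj1 (Cn_on_S U n u1) (HC1 _)) as [_ [D1 _]].
    destruct (proj1 (Cn_on_S U n u2) (HC2 _)) as [_ [D2 _]].
    apply Cn_on_ext with (fun q => u1 q * d1 u2 q + - (u2 q * d1 u1 q));
      auto using Cn_on_plus, Cn_on_mult, Cn_on_opp.
    intros q Hq. destruct (Ht q Hq) as [_ [E _]].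
    rewrite (d1_ext_on U u1 (fun q => cos (theta q)) q), d1_cos by
      (auto; intros; symmetry; now apply Hu).
    rewrite (d1_ext_on U u2 (fun q => sin (theta q)) q), d1_sin by
      (auto; intros; symmetry; now apply Hu).
    rewrite <- (proj1 (Hu q Hq)), <- (proj2 (Hu q Hq)).
    transitivity ((sin (theta q) * sin (theta q) + cos (theta q) * cos (theta q)) * d1 theta q);
      [ring | symmetry; apply Hcs].
  - destruct (proj1 (Cn_on_S U n u1) (HC1 _)) as [_ [_ D1]].
    destruct (proj1 (Cn_on_S U n u2) (HC2 _)) as [_ [_ D2]].
    apply Cn_on_ext with (fun q => u1 q * d2 u2 q + - (u2 q * d2 u1 q));
      auto using Cn_on_plus, Cn_on_mult, Cn_on_opp.
    intros q Hq. destruct (Ht q Hq) as [_ [_ E]].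
    rewrite (d2_ext_on U u1 (fun q => cos (theta q)) q), d2_cos by
      (auto; intros; symmetry; now apply Hu).
    rewrite (d2_ext_on U u2 (fun q => sin (theta q)) q), d2_sin by
      (auto; intros; symmetry; now apply Hu).
    rewrite <- (proj1 (Hu q Hq)), <- (proj2 (Hu q Hq)).
    transitivity ((sin (theta q) * sin (theta q) + cos (theta q) * cos (theta q)) * d2 theta q);
      [ring | symmetry; apply Hcs].
Qed.

Lemma local_lifting (Omega : R * R -> Prop) (u : R * R -> R * R) (p : R * R) :
  open Omega -> smooth_circle_field Omega u -> Omega p ->
  exists (U : R * R -> Prop) (theta : R * R -> R),
    open U /\ subset U Omega /\ U p /\ is_lifting U u theta.
Proof.
  intros HO [H1 [H2 Hn]] Hp.
  destruct (unit_vector_angle _ _ (Hn p Hp)) as [alpha [Hc Hs]].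
  (* [C q] and [D q] are the coordinates of [u q] along [u p] and along [perp (u p)]. *)
  set (C := fun q => cos alpha * fst (u q) + sin alpha * snd (u q)).
  set (D := fun q => cos alpha * snd (u q) - sin alpha * fst (u q)).
  assert (Hcont : forall q, Omega q ->
    continuity_2d_pt (fun x y => fst (u (x, y))) (fst q) (snd q) /\
    continuity_2d_pt (fun x y => snd (u (x, y))) (fst q) (snd q)).
  { intros q Hq. split; [apply (H1 q Hq 0%nat) | apply (H2 q Hq 0%nat)]. }
  assert (HC : forall q, Omega q -> continuity_2d_pt (fun x y => C (x, y)) (fst q) (snd q)).
  { intros q Hq. destruct (Hcont q Hq).
    apply continuity_2d_pt_plus; apply continuity_2d_pt_mult; auto;
      apply continuity_2d_pt_const. }
  assert (HD : forall q, Omega q -> continuity_2d_pt (fun x y => D (x, y)) (fst q) (snd q)).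
  { intros q Hq. destruct (Hcont q Hq).
    apply continuity_2d_pt_minus; apply continuity_2d_pt_mult; auto;
      apply continuity_2d_pt_const. }
  (* The points where [u q] makes an acute angle with [u p]; there the arctangent of [D q / C q]
     measures that angle. *)
  set (U := fun q => Omega q /\ 0 < C q).
  set (theta := fun q => alpha + atan (D q / C q)).
  assert (HU : open U).
  { apply locally_2d_open. intros q [Hq Hq0].
    apply locally_2d_and; [now apply open_locally_2d|].
    (* Continuity with tolerance [C q] itself keeps [C] positive nearby. *)
    generalize (HC q Hq (mkposreal _ Hq0)). apply locally_2d_impl, locally_2d_forall.
    intros x y H. apply Rabs_lt_between in H. simpl in H.
    replace (C (fst q, snd q)) with (C q) in H by now destruct q. lra. }
  assert (Hu : forall q, U q -> cos (theta q) = fst (u q) /\ sin (theta q) = snd (u q)).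
  { intros q [Hq Hq0]. apply angle_from_reference; auto. }
  exists U, theta. split; [|split; [|split; [|split]]]; auto.
  - intros q Hq; apply Hq.
  (* At [p] the coordinate [C p] is the squared norm of [u p], which is 1. *)
  - split; auto. unfold C. rewrite Hc, Hs.
    specialize (Hn p Hp). lra.
  - apply lifting_smooth with (fun q => fst (u q)) (fun q => snd (u q)); auto.
    + intros q [Hq _]; now apply H1.
    + intros q [Hq _]; now apply H2.
    + intros q [Hq Hq0].
      assert (E : (fst q, snd q) = q) by now destruct q.
      split; [|split].
      * apply continuity_2d_pt_plus; [apply continuity_2d_pt_const|].
        apply (continuity_1d_2d_pt_comp atan (fun x y => D (x, y) / C (x, y))).
        { apply derivable_continuous_pt. eexists. apply derivable_pt_lim_atan. }
        apply continuity_2d_pt_mult; auto. apply continuity_2d_pt_inv; auto.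
        rewrite E; lra.
      * destruct (H1 q Hq 1%nat) as [_ [F1 _]]. destruct (H2 q Hq 1%nat) as [_ [F2 _]].
        apply (ex_derive_angle alpha (fun z => fst (u (z, snd q))) (fun z => snd (u (z, snd q)))); auto.
        now rewrite E.
      * destruct (H1 q Hq 1%nat) as [_ [_ [F1 _]]]. destruct (H2 q Hq 1%nat) as [_ [_ [F2 _]]].
        apply (ex_derive_angle alpha (fun z => fst (u (fst q, z))) (fun z => snd (u (fst q, z)))); auto.
        now rewrite E.
  - intros q Hq. destruct (Hu q Hq) as [-> ->]. now destruct (u q).
Qed.

(** * One-variable tools: mean values and a Gronwall lemma *)

Lemma in_time_between (a b : Rbar) (t c : R) :
  in_time a b 0 -> in_time a b t -> Rmin 0 t <= c <= Rmax 0 t -> in_time a b c.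
Proof.
  intros [H0 H1] [H2 H3] [H4 H5]. split.
  - apply Rbar_lt_le_trans with (Rmin 0 t); [|exact H4]. unfold Rmin; now destruct Rle_dec.
  - apply Rbar_le_lt_trans with (Rmax 0 t); [exact H5|]. unfold Rmax; now destruct Rle_dec.
Qed.

Lemma in_time_locally (a b : Rbar) (t : R) (P : R -> Prop) :
  in_time a b t -> (forall z, in_time a b z -> P z) -> locally t P.
Proof.
  intros [H1 H2] H. apply locally_interval with a b; auto. intros y ? ?; apply H; now split.
Qed.

Lemma is_derive_continuity_pt (f : R -> R) (x l : R) : is_derive f x l -> continuity_pt f x.
Proof.
  intros H. apply continuity_pt_filterlim, (ex_derive_continuous f). now exists l.
Qed.

(** [Rmin] and [Rmax] let one statement serve both forward and backward times. *)
Lemma MVT_from_zero (a b : Rbar) (f df : R -> R) (t : R) :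
  (forall z, in_time a b z -> is_derive f z (df z)) ->
  in_time a b 0 -> in_time a b t ->
  exists c, Rmin 0 t <= c <= Rmax 0 t /\ f t - f 0 = df c * t.
Proof.
  intros Hf H0 Ht.
  destruct (MVT_gen f 0 t df) as [c [Hc E]].
  - intros x Hx. apply Hf, (in_time_between a b t); auto; lra.
  - intros x Hx. apply is_derive_continuity_pt with (df x).
    apply Hf, (in_time_between a b t); auto.
  - exists c. split; auto. now rewrite Rminus_0_r in E.
Qed.

Lemma eq_of_is_derive (a b : Rbar) (f g df : R -> R) :
  (forall z, in_time a b z -> is_derive f z (df z)) ->
  (forall z, in_time a b z -> is_derive g z (df z)) ->
  in_time a b 0 -> f 0 = g 0 -> forall t, in_time a b t -> f t = g t.
Proof.
  intros Hf Hg H0 E t Ht.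
  destruct (MVT_from_zero a b (fun z => f z - g z) (fun z => df z - df z) t) as [c [_ H]]; auto.
  - intros z Hz. apply (is_derive_minus f g); auto.
  - lra.
Qed.

(** On the compact interval between 0 and [t] the coefficient [k] is at most its maximum [K]. The
    mean value theorem for E(z) exp(m z), with m = -K forwards and m = K backwards, gives E(t) exp(m
    t) <= 0, and [E] is nonnegative. *)
Lemma gronwall_zero (a b : Rbar) (E dE k : R -> R) :
  (forall z, in_time a b z -> is_derive E z (dE z)) ->
  (forall z, in_time a b z -> continuity_pt k z) ->
  (forall z, in_time a b z -> Rabs (dE z) <= k z * E z) ->
  (forall z, 0 <= E z) ->
  in_time a b 0 -> E 0 = 0 -> forall t, in_time a b t -> E t = 0.
Proof.
  intros HE Hk Hb Hpos H0 E0 t Ht.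
  destruct (continuity_ab_maj k (Rmin 0 t) (Rmax 0 t)) as [M [HM _]].
  { apply Rle_trans with 0; [apply Rmin_l | apply Rmax_l]. }
  { intros c Hc. apply Hk. now apply in_time_between with t. }
  set (K := k M) in *.
  assert (Hb' : forall c, Rmin 0 t <= c <= Rmax 0 t -> - (K * E c) <= dE c <= K * E c).
  { intros c Hc. apply Rabs_le_between.
    apply Rle_trans with (k c * E c); [apply Hb; now apply in_time_between with t|].
    apply Rmult_le_compat_r; auto. }
  assert (HG : forall m, exists c, Rmin 0 t <= c <= Rmax 0 t /\
    E t * exp (m * t) = (dE c + m * E c) * exp (m * c) * t).
  { intros m.
    destruct (MVT_from_zero a b (fun z => E z * exp (m * z))
      (fun z => (dE z + m * E z) * exp (m * z)) t) as [c [Hc H]]; auto.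
    - intros z Hz. specialize (HE z Hz). auto_derive.
      + now exists (dE z).
      + change (Derive (fun x => E x) z) with (Derive E z). rewrite (is_derive_unique _ _ _ HE). ring.
    - exists c. split; auto. rewrite E0 in H. lra. }
  assert (Hle : forall m, E t * exp (m * t) <= 0 -> E t = 0).
  { intros m H. pose proof (exp_pos (m * t)). specialize (Hpos t). nra. }
  (* For m = -K the factor [dE c + m * E c] is nonpositive and [t] is not negative; for m = K both
     signs are reversed. *)
  destruct (Rle_dec 0 t) as [Hs|Hs].
  - destruct (HG (- K)) as [c [Hc H]]. apply (Hle (- K)). rewrite H.
    specialize (Hb' c Hc). pose proof (exp_pos (- K * c)).
    apply Rle_trans with (0 * t); [|lra]. apply Rmult_le_compat_r; auto. nra.
  - destruct (HG K) as [c [Hc H]]. apply (Hle K). rewrite H.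
    specialize (Hb' c Hc). pose proof (exp_pos (K * c)).
    assert (0 <= (dE c + K * E c) * exp (K * c)) by (apply Rmult_le_pos; lra). nra.
Qed.

Lemma Rabs_sin_minus_le (x y : R) : Rabs (sin x - sin y) <= Rabs (x - y).
Proof.
  destruct (MVT_gen sin y x cos) as [c [_ ->]].
  - intros; apply is_derive_sin.
  - intros; apply continuity_sin.
  - rewrite Rabs_mult. pose proof (Rabs_pos (x - y)).
    assert (Rabs (cos c) <= 1) by (apply Rabs_le, COS_bound). nra.
Qed.

Lemma Rabs_cos_minus_le (x y : R) : Rabs (cos x - cos y) <= Rabs (x - y).
Proof.
  destruct (MVT_gen cos y x (fun z => - sin z)) as [c [_ ->]].
  - intros; apply is_derive_cos.
  - intros; apply continuity_cos.
  - rewrite Rabs_mult, Rabs_Ropp. pose proof (Rabs_pos (x - y)).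
    assert (Rabs (sin c) <= 1) by (apply Rabs_le, SIN_bound). nra.
Qed.

(** * Angle and divergence along curves *)

(** Constancy of [v] comes first: it gives the equation for [theta] the constant right-hand side
    [v (y1, y2)]. *)
Lemma characteristic_values (U : R * R -> Prop) (theta v : R * R -> R) (y1 y2 : R)
    (a b : Rbar) (x1 x2 : R -> R) :
  open U -> Cn_on U 1 theta -> Cn_on U 1 v -> scalar_system U theta v ->
  in_time a b 0 -> (forall t, in_time a b t -> U (x1 t, x2 t)) ->
  is_characteristic theta y1 y2 a b x1 x2 ->
  forall t, in_time a b t ->
    theta (x1 t, x2 t) = v (y1, y2) * t + theta (y1, y2) /\
    v (x1 t, x2 t) = v (y1, y2).
Proof.
  intros HU Hth Hv Hs H0 Hin [E1 [E2 Hd]].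
  assert (Vc : forall t, in_time a b t -> v (x1 t, x2 t) = v (y1, y2)).
  { apply (eq_of_is_derive a b (fun t => v (x1 t, x2 t)) (fun _ => v (y1, y2)) (fun _ => 0)); auto.
    - intros z Hz. destruct (Hd z Hz) as [D1 D2].
      rewrite <- (proj2 (Hs _ (Hin z Hz))).
      evar_last; [apply (is_derive_along U v x1 x2 z); eauto|]. ring.
    - intros z Hz. exact (is_derive_const (v (y1, y2)) z).
    - now rewrite E1, E2. }
  intros t Ht. split; auto. revert t Ht.
  apply (eq_of_is_derive a b (fun t => theta (x1 t, x2 t))
    (fun t => v (y1, y2) * t + theta (y1, y2)) (fun _ => v (y1, y2))); auto.
  - intros z Hz. destruct (Hd z Hz) as [D1 D2]. rewrite <- (Vc z Hz).
    rewrite <- (proj1 (Hs _ (Hin z Hz))).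
    evar_last; [apply (is_derive_along U theta x1 x2 z); eauto|]. ring.
  - intros z Hz. auto_derive; auto; ring.
  - rewrite E1, E2. ring.
Qed.

(* Along a curve whose tangent angle is prescribed to be [w t + theta (y1, y2)],
   the errors [theta - (w t + theta (y1, y2))] and [v - w] solve a linear
   differential inequality with zero initial data. *)
Lemma prescribed_angle_values (U : R * R -> Prop) (theta v : R * R -> R) (y1 y2 : R)
    (a b : Rbar) (x1 x2 : R -> R) :
  open U -> Cn_on U 1 theta -> Cn_on U 1 v -> scalar_system U theta v ->
  in_time a b 0 -> (forall t, in_time a b t -> U (x1 t, x2 t)) ->
  x1 0 = y1 -> x2 0 = y2 ->
  (forall t, in_time a b t ->
     is_derive x1 t (- sin (v (y1, y2) * t + theta (y1, y2))) /\
     is_derive x2 t (cos (v (y1, y2) * t + theta (y1, y2)))) ->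
  forall t, in_time a b t ->
    theta (x1 t, x2 t) = v (y1, y2) * t + theta (y1, y2).
Proof.
  intros HU Hth Hv Hs H0 Hin E1 E2 Hd.
  set (w := v (y1, y2)) in *. set (th0 := theta (y1, y2)) in *.
  set (phi := fun t => theta (x1 t, x2 t) - (w * t + th0)).
  set (psi := fun t => v (x1 t, x2 t) - w).
  set (dphi := fun t => d1 theta (x1 t, x2 t) * - sin (w * t + th0)
                        + d2 theta (x1 t, x2 t) * cos (w * t + th0) - w).
  set (dpsi := fun t => d1 v (x1 t, x2 t) * - sin (w * t + th0)
                        + d2 v (x1 t, x2 t) * cos (w * t + th0)).
  set (A := fun t => Rabs (d1 theta (x1 t, x2 t)) + Rabs (d2 theta (x1 t, x2 t))).
  set (B := fun t => Rabs (d1 v (x1 t, x2 t)) + Rabs (d2 v (x1 t, x2 t))).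
  assert (Dphi : forall t, in_time a b t -> is_derive phi t (dphi t)).
  { intros t Ht. destruct (Hd t Ht) as [D1 D2].
    apply (is_derive_minus (fun t => theta (x1 t, x2 t))).
    - apply (is_derive_along U); eauto.
    - auto_derive; auto; ring. }
  assert (Dpsi : forall t, in_time a b t -> is_derive psi t (dpsi t)).
  { intros t Ht. destruct (Hd t Ht) as [D1 D2]. evar_last.
    - apply (is_derive_minus (fun t => v (x1 t, x2 t)) (fun _ => w)).
      + apply (is_derive_along U); eauto.
      + exact (is_derive_const w t).
    - apply Rminus_0_r. }
  (* The cost of replacing the direction given by [theta] with the prescribed one; sine and cosine
     are 1-Lipschitz, so it is controlled by [phi]. *)
  assert (Hrot : forall p q t, Rabs (p * (sin (theta (x1 t, x2 t)) - sin (w * t + th0))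
      + q * (cos (w * t + th0) - cos (theta (x1 t, x2 t))))
      <= (Rabs p + Rabs q) * Rabs (phi t)).
  { intros p q t. eapply Rle_trans; [apply Rabs_triang|]. rewrite !Rabs_mult.
    pose proof (Rabs_sin_minus_le (theta (x1 t, x2 t)) (w * t + th0)).
    pose proof (Rabs_cos_minus_le (theta (x1 t, x2 t)) (w * t + th0)).
    rewrite (Rabs_minus_sym (cos (w * t + th0))).
    fold (phi t) in *. pose proof (Rabs_pos p). pose proof (Rabs_pos q). nra. }
  assert (Bphi : forall t, in_time a b t -> Rabs (dphi t) <= A t * Rabs (phi t) + Rabs (psi t)).
  { intros t Ht. destruct (Hs _ (Hin t Ht)) as [S1 _].
    (* Subtracting the first scalar equation splits the derivative into the change of direction and
       [psi], the error in [v]. *)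
    replace (dphi t) with (d1 theta (x1 t, x2 t) * (sin (theta (x1 t, x2 t)) - sin (w * t + th0))
      + d2 theta (x1 t, x2 t) * (cos (w * t + th0) - cos (theta (x1 t, x2 t))) + psi t)
      by (unfold dphi, psi; rewrite <- S1; ring).
    eapply Rle_trans; [apply Rabs_triang|]. apply Rplus_le_compat_r, Hrot. }
  assert (Bpsi : forall t, in_time a b t -> Rabs (dpsi t) <= B t * Rabs (phi t)).
  { intros t Ht. destruct (Hs _ (Hin t Ht)) as [_ S2].
    replace (dpsi t) with (d1 v (x1 t, x2 t) * (sin (theta (x1 t, x2 t)) - sin (w * t + th0))
      + d2 v (x1 t, x2 t) * (cos (w * t + th0) - cos (theta (x1 t, x2 t)))).
    - apply Hrot.
    - unfold dpsi. lra. }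
  assert (Hc : forall f t, in_time a b t -> Cn_on U 0 f ->
    continuity_pt (fun t => Rabs (f (x1 t, x2 t))) t).
  { intros f t Ht Hf. destruct (Hd t Ht) as [D1 D2].
    apply (continuity_pt_comp (fun t => f (x1 t, x2 t)) Rabs); [|apply Rcontinuity_abs].
    apply continuity_pt_filterlim.
    apply (filterlim_comp_2 x1 x2 (fun x y => f (x, y)) (G := locally (x1 t)) (H := locally (x2 t))).
    - apply continuity_pt_filterlim. eapply is_derive_continuity_pt, D1.
    - apply continuity_pt_filterlim. eapply is_derive_continuity_pt, D2.
    - generalize (Cn_on_continuity U 0 f _ Hf (Hin t Ht)). intros H.
      apply continuity_2d_pt_filterlim in H. simpl in H.
      eapply filterlim_filter_le_1; [|exact H].
      (* A ball of the plane is a product of balls, so the product filter is finer than the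
         neighbourhood filter. *)
      intros P [e He]. exists (fun y => ball (x1 t) e y) (fun y => ball (x2 t) e y);
        [apply locally_ball | apply locally_ball |].
      intros y z Hy Hz. apply He. now split. }
  apply Cn_on_S in Hth. apply Cn_on_S in Hv.
  destruct Hth as [_ [Hth1 Hth2]], Hv as [_ [Hv1 Hv2]].
  intros t Ht.
  (* The sum of squares is differentiable, unlike the absolute values. With X = |phi| and Y = |psi|,
     its derivative is at most 2 A X^2 + 2 (1 + B) X Y, and 2 X Y <= X^2 + Y^2 gives the coefficient
     2 A + B + 1. *)
  assert (HE : phi t ^ 2 + psi t ^ 2 = 0).
  { apply (gronwall_zero a b (fun t => phi t ^ 2 + psi t ^ 2)
      (fun t => 2 * phi t * dphi t + 2 * psi t * dpsi t) (fun t => 2 * A t + B t + 1)); auto.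
    - intros z Hz. specialize (Dphi z Hz). specialize (Dpsi z Hz). auto_derive.
      + repeat split; eexists; eassumption.
      + change (Derive (fun x => phi x) z) with (Derive phi z).
        change (Derive (fun x => psi x) z) with (Derive psi z).
        rewrite (is_derive_unique _ _ _ Dphi), (is_derive_unique _ _ _ Dpsi). ring.
    - intros z Hz.
      assert (HA : continuity_pt A z).
      { apply (continuity_pt_plus (fun t => Rabs (d1 theta (x1 t, x2 t)))
          (fun t => Rabs (d2 theta (x1 t, x2 t)))); now apply Hc. }
      assert (HB : continuity_pt B z).
      { apply (continuity_pt_plus (fun t => Rabs (d1 v (x1 t, x2 t)))
          (fun t => Rabs (d2 v (x1 t, x2 t)))); now apply Hc. }
      apply (continuity_pt_plus (fun t => 2 * A t + B t) (fun _ => 1));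
        [|now apply continuity_pt_const].
      apply (continuity_pt_plus (fun t => 2 * A t) B); auto.
      now apply (continuity_pt_scal A).
    - intros z Hz. specialize (Bphi z Hz). specialize (Bpsi z Hz).
      eapply Rle_trans; [apply Rabs_triang|]. rewrite !Rabs_mult, (Rabs_pos_eq 2) by lra.
      rewrite <- (pow2_abs (phi z)), <- (pow2_abs (psi z)).
      pose proof (Rabs_pos (phi z)). pose proof (Rabs_pos (psi z)).
      assert (0 <= A z) by (unfold A; pose proof (Rabs_pos (d1 theta (x1 z, x2 z)));
        pose proof (Rabs_pos (d2 theta (x1 z, x2 z))); lra).
      assert (0 <= B z) by (unfold B; pose proof (Rabs_pos (d1 v (x1 z, x2 z)));
        pose proof (Rabs_pos (d2 v (x1 z, x2 z))); lra).
      set (X := Rabs (phi z)) in *. set (Y := Rabs (psi z)) in *.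
      assert (2 * X * Rabs (dphi z) <= 2 * X * (A z * X + Y)) by (apply Rmult_le_compat_l; lra).
      assert (2 * Y * Rabs (dpsi z) <= 2 * Y * (B z * X)) by (apply Rmult_le_compat_l; lra).
      assert (0 <= (1 + B z) * (X - Y) ^ 2) by (apply Rmult_le_pos; [lra | apply pow2_ge_0]).
      assert (0 <= A z * Y ^ 2) by (apply Rmult_le_pos; [lra | apply pow2_ge_0]).
      lra.
    - intros z. pose proof (pow2_ge_0 (phi z)). pose proof (pow2_ge_0 (psi z)). lra.
    - unfold phi, psi. rewrite E1, E2. fold w th0. ring. }
  assert (phi t = 0) by (pose proof (pow2_ge_0 (psi t)); nra).
  unfold phi in *. lra.
Qed.

(** Trades the nonlinear equation, whose right-hand side depends on the curve through [theta], for
    explicit derivatives in [t]; only integration remains. *)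
Lemma characteristic_iff_prescribed_angle (U : R * R -> Prop) (theta v : R * R -> R)
    (y1 y2 : R) (a b : Rbar) (x1 x2 : R -> R) :
  open U -> Cn_on U 1 theta -> Cn_on U 1 v -> scalar_system U theta v ->
  in_time a b 0 -> (forall t, in_time a b t -> U (x1 t, x2 t)) ->
  is_characteristic theta y1 y2 a b x1 x2 <->
  x1 0 = y1 /\ x2 0 = y2 /\
  forall t, in_time a b t ->
     is_derive x1 t (- sin (v (y1, y2) * t + theta (y1, y2))) /\
     is_derive x2 t (cos (v (y1, y2) * t + theta (y1, y2))).
Proof.
  intros HU Hth Hv Hs H0 Hin. split.
  - intros H. pose proof H as [E1 [E2 Hd]]. split; [|split]; auto.
    intros t Ht.
    rewrite <- (proj1 (characteristic_values U theta v y1 y2 a b x1 x2 HU Hth Hv Hs H0 Hin H t Ht)).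
    auto.
  - intros [E1 [E2 Hd]]. split; [|split]; auto. intros t Ht.
    rewrite (prescribed_angle_values U theta v y1 y2 a b x1 x2); auto.
Qed.

(** * Explicit characteristics: arcs, lines and curvature *)

(** Common to arcs and lines. For the converse, the time interval is open, so equality on it passes
    to derivatives. *)
Lemma derivatives_iff_primitives (a b : Rbar) (F1 F2 f1 f2 x1 x2 : R -> R) (y1 y2 : R) :
  in_time a b 0 -> F1 0 = y1 -> F2 0 = y2 ->
  (forall t, is_derive F1 t (f1 t)) -> (forall t, is_derive F2 t (f2 t)) ->
  (x1 0 = y1 /\ x2 0 = y2 /\
   forall t, in_time a b t -> is_derive x1 t (f1 t) /\ is_derive x2 t (f2 t)) <->
  (forall t, in_time a b t -> x1 t = F1 t /\ x2 t = F2 t).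
Proof.
  intros H0 HF1 HF2 D1 D2. split.
  - intros [E1 [E2 H]] t Ht. split.
    + apply (eq_of_is_derive a b x1 F1 f1); auto; [apply H | now rewrite E1].
    + apply (eq_of_is_derive a b x2 F2 f2); auto; [apply H | now rewrite E2].
  - intros H. split; [|split].
    + rewrite <- HF1. now apply H.
    + rewrite <- HF2. now apply H.
    + intros t Ht. split.
      * apply is_derive_ext_loc with F1; auto.
        apply in_time_locally with a b; auto. intros z Hz; symmetry; now apply H.
      * apply is_derive_ext_loc with F2; auto.
        apply in_time_locally with a b; auto. intros z Hz; symmetry; now apply H.
Qed.

(** The curve has unit speed, so its curvature is the rate at which the tangent angle turns. *)
Lemma curvature_linear_angle (a b : Rbar) (x1 x2 : R -> R) (w th0 t : R) :
  (forall z, in_time a b z ->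
     is_derive x1 z (- sin (w * z + th0)) /\ is_derive x2 z (cos (w * z + th0))) ->
  in_time a b t -> curvature x1 x2 t = w.
Proof.
  intros H Ht. unfold curvature.
  (* The second derivative at [t] requires the first one on a neighbourhood of [t], not only at
     [t]. *)
  assert (E1 : Derive_n x1 2 t = Derive (fun z => - sin (w * z + th0)) t).
  { apply Derive_ext_loc, in_time_locally with a b; auto.
    intros z Hz. apply is_derive_unique, H, Hz. }
  assert (E2 : Derive_n x2 2 t = Derive (fun z => cos (w * z + th0)) t).
  { apply Derive_ext_loc, in_time_locally with a b; auto.
    intros z Hz. apply is_derive_unique, H, Hz. }
  rewrite E1, E2.
  rewrite (is_derive_unique _ _ _ (proj1 (H t Ht))), (is_derive_unique _ _ _ (proj2 (H t Ht))).
  assert (D1 : is_derive (fun z : R => - sin (w * z + th0)) t (- (w * cos (w * t + th0)))).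
  { auto_derive; auto; ring. }
  assert (D2 : is_derive (fun z : R => cos (w * z + th0)) t (- (w * sin (w * t + th0)))).
  { auto_derive; auto; ring. }
  rewrite (is_derive_unique _ _ _ D1), (is_derive_unique _ _ _ D2).
  pose proof (sin2_cos2 (w * t + th0)) as E. unfold Rsqr in E.
  replace ((- sin (w * t + th0)) ^ 2 + cos (w * t + th0) ^ 2) with 1 by lra.
  rewrite sqrt_1, pow1. unfold Rdiv. rewrite Rinv_1, Rmult_1_r.
  transitivity (w * (sin (w * t + th0) * sin (w * t + th0) + cos (w * t + th0) * cos (w * t + th0)));
    [ring | rewrite E; ring].
Qed.

Lemma characteristic_iff_arc (U : R * R -> Prop) (theta v : R * R -> R)
    (y1 y2 : R) (a b : Rbar) (x1 x2 : R -> R) :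
  open U -> Cn_on U 1 theta -> Cn_on U 1 v -> scalar_system U theta v ->
  in_time a b 0 -> (forall t, in_time a b t -> U (x1 t, x2 t)) ->
  v (y1, y2) <> 0 ->
  is_characteristic theta y1 y2 a b x1 x2 <->
  forall t, in_time a b t ->
    x1 t = / v (y1, y2) * (cos (v (y1, y2) * t + theta (y1, y2)) - cos (theta (y1, y2))) + y1 /\
    x2 t = / v (y1, y2) * (sin (v (y1, y2) * t + theta (y1, y2)) - sin (theta (y1, y2))) + y2.
Proof.
  intros HU Hth Hv Hs H0 Hin Hw.
  eapply iff_trans; [now apply (characteristic_iff_prescribed_angle U theta v)|].
  apply derivatives_iff_primitives; auto; try (rewrite Rmult_0_r, Rplus_0_l; ring).
  - intros t. auto_derive; auto; now field.
  - intros t. auto_derive; auto; now field.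
Qed.

Lemma characteristic_iff_line (U : R * R -> Prop) (theta v : R * R -> R)
    (y1 y2 : R) (a b : Rbar) (x1 x2 : R -> R) :
  open U -> Cn_on U 1 theta -> Cn_on U 1 v -> scalar_system U theta v ->
  in_time a b 0 -> (forall t, in_time a b t -> U (x1 t, x2 t)) ->
  v (y1, y2) = 0 ->
  is_characteristic theta y1 y2 a b x1 x2 <->
  forall t, in_time a b t ->
    x1 t = y1 - t * sin (theta (y1, y2)) /\ x2 t = y2 + t * cos (theta (y1, y2)).
Proof.
  intros HU Hth Hv Hs H0 Hin Hw.
  eapply iff_trans; [now apply (characteristic_iff_prescribed_angle U theta v)|].
  rewrite Hw.
  apply derivatives_iff_primitives; auto; try ring;
    intros t; auto_derive; auto; rewrite Rmult_0_l, Rplus_0_l; ring.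
Qed.

(** The arc is its centre plus (cos, sin)(w t + th0) divided by [w]; the constant terms of the
    formulas form the centre. *)
Lemma arc_on_circle (w th0 y1 y2 t : R) :
  w <> 0 ->
  on_circle (y1 - / w * cos th0, y2 - / w * sin th0) (/ Rabs w)
    (/ w * (cos (w * t + th0) - cos th0) + y1, / w * (sin (w * t + th0) - sin th0) + y2).
Proof.
  intros Hw. unfold on_circle; simpl fst; simpl snd.
  rewrite <- Rabs_inv, pow2_abs.
  pose proof (sin2_cos2 (w * t + th0)) as E. unfold Rsqr in E.
  rewrite <- (Rmult_1_r ((/ w) ^ 2)), <- E. ring.
Qed.

Theorem corollary3p11 (Omega : R * R -> Prop) (u : R * R -> R * R)
  (hOmega : open Omega) (hu : smooth_circle_field Omega u) :
  (forall p, Omega p ->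
     exists (U : R * R -> Prop) (theta : R * R -> R),
       open U /\ subset U Omega /\ U p /\ is_lifting U u theta)
  /\
  (forall (U : R * R -> Prop) (theta v : R * R -> R),
     open U -> subset U Omega -> is_lifting U u theta ->
     ((forall p, U p -> v p = div u p) /\ div_equation U u)
     <-> scalar_system U theta v)
  /\
  (div_equation Omega u ->
   forall (U : R * R -> Prop) (theta v : R * R -> R),
     open U -> subset U Omega -> is_lifting U u theta ->
     (forall p, U p -> v p = div u p) ->
   forall (S : R -> Prop) (x10 x20 theta0 v0 : R -> R),
     (forall s, S s -> U (x10 s, x20 s)) ->
     (forall s, S s -> theta0 s = theta (x10 s, x20 s)) ->
     (forall s, S s -> v0 s = v (x10 s, x20 s)) ->
   forall (a b : R -> Rbar) (x1 x2 : R -> R -> R) (s : R),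
     S s -> in_time (a s) (b s) 0 ->
     (forall t, in_time (a s) (b s) t -> U (x1 s t, x2 s t)) ->
     (v0 s <> 0 ->
        (is_characteristic theta (x10 s) (x20 s) (a s) (b s) (x1 s) (x2 s)
         <->
         forall t, in_time (a s) (b s) t ->
           x1 s t = / v0 s * (cos (v0 s * t + theta0 s) - cos (theta0 s)) + x10 s /\
           x2 s t = / v0 s * (sin (v0 s * t + theta0 s) - sin (theta0 s)) + x20 s))
     /\
     (v0 s = 0 ->
        (is_characteristic theta (x10 s) (x20 s) (a s) (b s) (x1 s) (x2 s)
         <->
         forall t, in_time (a s) (b s) t ->
           x1 s t = x10 s - t * sin (theta0 s) /\
           x2 s t = x20 s + t * cos (theta0 s)))
     /\
     (is_characteristic theta (x10 s) (x20 s) (a s) (b s) (x1 s) (x2 s) ->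
        (forall t, in_time (a s) (b s) t ->
           theta (x1 s t, x2 s t) = v0 s * t + theta0 s /\
           v (x1 s t, x2 s t) = v0 s /\
           div u (x1 s t, x2 s t) = v0 s /\
           curvature (x1 s) (x2 s) t = v0 s)
        /\
        (v0 s <> 0 -> exists c : R * R, forall t, in_time (a s) (b s) t ->
           on_circle c (/ Rabs (v0 s)) (x1 s t, x2 s t)))).
Proof.
  split; [|split].
  - intros p Hp. now apply local_lifting.
  - intros U theta v HU HUO Hl. now apply div_equation_iff_scalar_system.
  - intros He U theta v HU HUO Hl Hv S x10 x20 theta0 v0 HS Hth0 Hv0 a b x1 x2 s Hs H0 Hin.
    assert (Hsys : scalar_system U theta v).
    { apply (div_equation_iff_scalar_system U u theta v); auto. split; auto.
      intros p Hp. apply He, HUO, Hp. }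
    assert (Cth : Cn_on U 1 theta) by (intros p Hp; now apply (proj1 Hl)).
    (* [v] is known only through its agreement with [div u] on [U]; it is C^1 because [u] is C^2. *)
    assert (Cv : Cn_on U 1 v).
    { apply Cn_on_ext with (div u); auto.
      - intros q Hq. symmetry. now apply Hv.
      - apply Cn_on_div; auto; intros p Hp; now apply hu, HUO. }
    (* With [s] fixed, only the values of [theta] and [v] at the starting point matter. *)
    rewrite (Hth0 s Hs), (Hv0 s Hs).
    split; [|split].
    + intros Hw. now apply (characteristic_iff_arc U).
    + intros Hw. now apply (characteristic_iff_line U theta v).
    + intros Hch. split.
      * intros t Ht.
        destruct (characteristic_values U theta v _ _ _ _ _ _ HU Cth Cv Hsys H0 Hin Hch t Ht)
          as [T V].
        rewrite <- (Hv _ (Hin t Ht)). repeat split; auto.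
        apply (curvature_linear_angle (a s) (b s) (x1 s) (x2 s) _ (theta (x10 s, x20 s))); auto.
        now apply (characteristic_iff_prescribed_angle U theta v).
      (* The centre is supplied by unification with [arc_on_circle]. *)
      * intros Hw. eexists. intros t Ht.
        destruct (proj1 (characteristic_iff_arc U theta v _ _ _ _ _ _ HU Cth Cv Hsys H0 Hin Hw)
          Hch t Ht) as [-> ->].
        now apply arc_on_circle.
Qed.
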